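(* Let $K$ be a quadratic field with embeddings into $\mathbb{R}$ and $\mathbb{Q}_2$. Let $\alpha\in K\setminus\mathbb{Q}$ have property $I$, and assume that there exists an odd integer $n_1>1$ such that $\alpha_{(1)}=\alpha_{(n_1)}$, where $\{\alpha_{(n)}\}$ is generated by the algorithm described in the context. Let $\bar\alpha$ be the conjugate of $\alpha$. Then $$(\alpha_{\langle 2\rangle},\bar\alpha_{\langle 2\rangle})\in D_2^1\quad\text{and}\quad(\alpha_\infty,\bar\alpha_\infty)\in D_\infty^1,$$ where $D_2^1=\{(x,y)\in\mathbb{Q}_2^2\mid v_2(x)>0,\ v_2(y)\le0\}$ and $D_\infty^1=\{(x,y)\in\mathbb{R}^2\mid |x|\le1,\ |x-y|>1\}$.
   Context: $K$ is a quadratic field with fixed field embeddings $\sigma_\infty:K\to\mathbb{R}$ and $\sigma_2:K\to\mathbb{Q}_2$. For $\alpha\in K$ write $\alpha_\infty=\sigma_\infty(\alpha)$, $\alpha_{\langle 2\rangle}=\sigma_2(\alpha)$, and $\bar\alpha\in K$ for the Galois conjugate of $\alpha$ over $\mathbb{Q}$. For $u=\sum_{n}c_n2^n\in\mathbb{Q}_2$ with digits $c_n\in\{0,1\}$ ($c_n=0$ for $n<v_2(u)$), put $\lfloor u\rfloor_2=\sum_{n\le 0}c_n2^n\in\mathbb{Z}[1/2]$. Property $I$: $\alpha_\infty\in(-1,1]$ and $v_2(\alpha_{\langle 2\rangle})>0$. For $\alpha\in K^\times$ let $a^{(0)}(\alpha)=2m+\lfloor(1/\alpha)_{\langle 2\rangle}\rfloor_2$,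 where $m$ is the smallest among the integers $i$ minimizing $|(1/\alpha)_\infty-2i-\lfloor(1/\alpha)_{\langle 2\rangle}\rfloor_2|$; let $a^{(1)}(\alpha)=m'+\lfloor(1/\alpha)_{\langle 2\rangle}\rfloor_2$, where $m'$ is the smallest among the integers $i$ minimizing $|(1/\alpha)_\infty-i-\lfloor(1/\alpha)_{\langle 2\rangle}\rfloor_2|$. Put $T_{2,\epsilon}(\alpha)=\frac1\alpha-a^{(\epsilon)}(\alpha)$ for $\epsilon\in\{0,1\}$. Algorithm: $\alpha_{(1)}=\alpha$; for $n\ge1$, $\alpha_{(n+1)}=T_{2,0}(\alpha_{(n)})$ if $n$ is even and $\alpha_{(n+1)}=T_{2,1}(\alpha_{(n)})$ if $n$ is odd (for $\alpha\in K\setminus\mathbb{Q}$ the algorithm never terminates). *)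

(* Defs.v *)
From HB Require Import structures.
From mathcomp Require Import all_boot all_order all_algebra all_field.
From mathcomp Require Import all_classical all_reals topology.

Set Implicit Arguments.
Unset Strict Implicit.
Unset Printing Implicit Defensive.

Import Order.TTheory GRing.Theory Num.Theory.
Local Open Scope classical_set_scope.
Local Open Scope ring_scope.

(* MathComp has no p-adic numbers.  Z2 is the inverse limit of the rings
   Z / 2 ^ n, the class modulo 2 ^ n being represented by its remainder in
   [0, 2 ^ n[, and Q2 is its field of fractions. *)

Record Z2 := MkZ2 {
  z2mod : nat -> int;
  z2modP : forall n, (z2mod n.+1 %% 2 ^+ n)%Z = z2mod n }.

HB.instance Definition _ := gen_eqMixin Z2.
HB.instance Definition _ := gen_choiceMixin Z2.

Lemma z2_ext (x y : Z2) : (forall n, z2mod x n = z2mod y n) -> x = y.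
Proof.
case: x y => [f hf] [g hg] /= /funext fg; subst g.
by congr MkZ2; apply: Prop_irrelevance.
Qed.

Lemma z2mod_small (x : Z2) n : (z2mod x n %% 2 ^+ n)%Z = z2mod x n.
Proof. by rewrite -(z2modP x n) modz_mod. Qed.

Lemma modz_pow2S (m : int) n :
  ((m %% 2 ^+ n.+1)%Z %% 2 ^+ n)%Z = (m %% 2 ^+ n)%Z.
Proof.
rewrite [in RHS](divz_eq m (2 ^+ n.+1)) exprS mulrA modzMDl.
by rewrite -exprS.
Qed.

Lemma z2_mk_subproof (f : nat -> int) :
  (forall n, (f n.+1 %% 2 ^+ n)%Z = (f n %% 2 ^+ n)%Z) ->
  forall n, ((f n.+1 %% 2 ^+ n.+1)%Z %% 2 ^+ n)%Z = (f n %% 2 ^+ n)%Z.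
Proof. by move=> h n; rewrite modz_pow2S. Qed.

Definition z2_mk (f : nat -> int)
    (h : forall n, (f n.+1 %% 2 ^+ n)%Z = (f n %% 2 ^+ n)%Z) : Z2 :=
  MkZ2 (z2_mk_subproof h).

Lemma z2_const_subproof (k : int) n : (k %% 2 ^+ n)%Z = (k %% 2 ^+ n)%Z.
Proof. by []. Qed.

Lemma z2_opp_subproof (x : Z2) n :
  (- z2mod x n.+1 %% 2 ^+ n)%Z = (- z2mod x n %% 2 ^+ n)%Z.
Proof. by rewrite -(z2modP x n) modzNm. Qed.

Lemma z2_add_subproof (x y : Z2) n :
  ((z2mod x n.+1 + z2mod y n.+1) %% 2 ^+ n)%Z =
  ((z2mod x n + z2mod y n) %% 2 ^+ n)%Z.
Proof. by rewrite -(z2modP x n) -(z2modP y n) modzDm. Qed.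

Lemma z2_mul_subproof (x y : Z2) n :
  ((z2mod x n.+1 * z2mod y n.+1) %% 2 ^+ n)%Z =
  ((z2mod x n * z2mod y n) %% 2 ^+ n)%Z.
Proof. by rewrite -(z2modP x n) -(z2modP y n) modzMm. Qed.

Definition z2_const (k : int) : Z2 := z2_mk (z2_const_subproof k).
Definition z2_opp (x : Z2) : Z2 := z2_mk (z2_opp_subproof x).
Definition z2_add (x y : Z2) : Z2 := z2_mk (z2_add_subproof x y).
Definition z2_mul (x y : Z2) : Z2 := z2_mk (z2_mul_subproof x y).

Lemma z2_addA : associative z2_add.
Proof. by move=> x y z; apply: z2_ext => n /=; rewrite modzDml modzDmr addrA. Qed.

Lemma z2_addC : commutative z2_add.
Proof. by move=> x y; apply: z2_ext => n /=; rewrite addrC. Qed.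

Lemma z2_add0 : left_id (z2_const 0) z2_add.
Proof. by move=> x; apply: z2_ext => n /=; rewrite modzDml add0r z2mod_small. Qed.

Lemma z2_addN : left_inverse (z2_const 0) z2_opp z2_add.
Proof. by move=> x; apply: z2_ext => n /=; rewrite modzDml addNr. Qed.

HB.instance Definition _ :=
  GRing.isZmodule.Build Z2 z2_addA z2_addC z2_add0 z2_addN.

Lemma z2_mulA : associative z2_mul.
Proof. by move=> x y z; apply: z2_ext => n /=; rewrite modzMml modzMmr mulrA. Qed.

Lemma z2_mulC : commutative z2_mul.
Proof. by move=> x y; apply: z2_ext => n /=; rewrite mulrC. Qed.

Lemma z2_mul1 : left_id (z2_const 1) z2_mul.
Proof. by move=> x; apply: z2_ext => n /=; rewrite modzMml mul1r z2mod_small. Qed.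

Lemma z2_mulDl : left_distributive z2_mul z2_add.
Proof.
move=> x y z; apply: z2_ext => n /=.
by rewrite modzMml modzDm mulrDl.
Qed.

Lemma z2_oner_neq0 : z2_const 1 != z2_const 0.
Proof. by apply/eqP => /(congr1 (fun x => z2mod x 1)). Qed.

HB.instance Definition _ := GRing.Zmodule_isComNzRing.Build Z2
  z2_mulA z2_mulC z2_mul1 z2_mulDl z2_oner_neq0.

Definition z2_unit : pred Z2 := fun x => `[< exists y, y * x = 1 >].
Definition z2_inv (x : Z2) : Z2 := xget x [set y | y * x = 1].

Lemma z2_mulVx : {in z2_unit, left_inverse 1 z2_inv *%R}.
Proof.
move=> x /asboolP[y xy]; rewrite /z2_inv.
by case: xgetP => [z _ //|/(_ y)]; case.
Qed.

Lemma z2_unitPl (x y : Z2) : y * x = 1 -> z2_unit x.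
Proof. by move=> xy; apply/asboolP; exists y. Qed.

Lemma z2_inv_out : {in [predC z2_unit], z2_inv =1 id}.
Proof.
move=> x /asboolP xN; rewrite /z2_inv.
by case: xgetP => // y _ xy; case: xN; exists y.
Qed.

HB.instance Definition _ := GRing.ComNzRing_hasMulInverse.Build Z2
  z2_mulVx z2_unitPl z2_inv_out.

(* The 2-adic valuation of x != 0: the largest n such that x = 0 mod 2 ^ n. *)
Definition z2_ord (x : Z2) : nat :=
  xget 0%N [set n : nat | z2mod x n = 0 /\ z2mod x n.+1 <> 0].

Lemma z2mod0 (x : Z2) : z2mod x 0 = 0.
Proof. by rewrite -z2mod_small expr0 modz1. Qed.

Lemma z2_ordP (x : Z2) : x != 0 ->
  z2mod x (z2_ord x) = 0 /\ z2mod x (z2_ord x).+1 <> 0.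
Proof.
move=> x0; rewrite /z2_ord; case: xgetP => [n _ //|none].
case/eqP: x0; apply: z2_ext => n /=; rewrite mod0z.
elim: n => [|n IHn]; first exact: z2mod0.
by apply: contrapT => xn; apply: (none n).
Qed.

Lemma z2modD (x : Z2) n k : (z2mod x (n + k) %% 2 ^+ n)%Z = z2mod x n.
Proof.
elim: k => [|k IHk]; first by rewrite addn0 z2mod_small.
rewrite -IHk addnS -(z2modP x (n + k)) exprD.
by rewrite [in LHS](divz_eq (z2mod x (n + k).+1) (2 ^+ n * 2 ^+ k))
  [2 ^+ n * _]mulrC mulrA modzMDl.
Qed.

Lemma z2_ord_odd (x : Z2) k : x != 0 -> exists2 q : int,
  z2mod x ((z2_ord x).+1 + k)%N = q * 2 ^+ z2_ord x & ~~ (2 %| q)%Z.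
Proof.
move=> /z2_ordP[]; set n := z2_ord x => xn xSn.
have /dvdzP[q xq] : (2 ^+ n %| z2mod x (n.+1 + k)%N)%Z.
  by apply/dvdz_mod0P; rewrite addSnnS z2modD.
exists q => //; apply/negP => /dvdzP[r qr].
by case: xSn; rewrite -(z2modD x n.+1 k) xq qr -mulrA -exprS modzMl.
Qed.

Lemma z2_integral : GRing.integral_domain_axiom Z2.
Proof.
move=> x y xy; apply: contraT; rewrite negb_or => /andP[x0 y0].
have [q xq qN] := z2_ord_odd (z2_ord y) x0.
have [r yr rN] := z2_ord_odd (z2_ord x) y0.
move: xy => /(congr1 (fun z => z2mod z (z2_ord x + z2_ord y).+1)) /=.
rewrite mod0z -{1}addSn xq [X in z2mod y X](_ : _ = (z2_ord y).+1 + z2_ord x)%N;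
  last by rewrite addSn addnC.
rewrite yr mulrACA -exprD => /dvdz_mod0P; rewrite exprS dvdz_mul2r ?expf_neq0//.
by rewrite dvdzE abszM Euclid_dvdM// -!dvdzE (negbTE qN) (negbTE rN).
Qed.

HB.instance Definition _ := GRing.ComUnitRing_isIntegral.Build Z2 z2_integral.

Notation Q2 := {fraction Z2}.

Definition v2 (u : Q2) : \bar int :=
  if u == 0 then +oo%E
  else ((z2_ord \n_(repr u))%:Z - (z2_ord \d_(repr u))%:Z)%:E.

Definition cvg2 (s : nat -> Q2) (u : Q2) : Prop :=
  forall M : int, \forall k \near \oo, (M%:E <= v2 (u - s k)%R)%E.

(* \sum_(n \in A) is 0 on infinite support; here the support is finite because
   c vanishes below the valuation (everywhere when u = 0). *)
Definition is_digits (u : Q2) (c : int -> bool) : Prop :=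
  (forall n : int, (n%:E < v2 u)%E -> c n = false) /\
  cvg2 (fun N : nat => \sum_(n \in [set n : int | n <= N%:Z])
     (c n)%:R * (2 : Q2) ^ n) u.

Definition digits (u : Q2) : int -> bool :=
  xget (fun=> false) [set c | is_digits u c].

Definition floor2 (u : Q2) : rat :=
  \sum_(n \in [set n : int | n <= 0]) (digits u n)%:R * (2 : rat) ^ n.

Section algorithm.
Variables (R : realType) (K : fieldExtType rat).
Variables (soo : {rmorphism K -> R}) (s2 : {rmorphism K -> Q2}).

Definition property_I (alpha : K) : Prop :=
  (-1 < soo alpha <= 1) /\ (0 < v2 (s2 alpha))%E.

Definition smallest_minimizer (f : int -> R) : int :=
  xget 0 [set m : int | (forall i, f m <= f i) /\
                        (forall m', (forall i, f m' <= f i) -> m <= m')].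

(* The integer part a^(eps) is m * step eps + floor2 (1 / alpha), where
   eps = false, true stands for eps = 0, 1. *)
Definition step (eps : bool) : int := if eps then 1 else 2.

Definition a2 (eps : bool) (alpha : K) : rat :=
  let fl := floor2 (s2 alpha^-1) in
  let m := smallest_minimizer (fun i =>
    `|soo alpha^-1 - (step eps * i)%:~R - ratr fl|) in
  (step eps * m)%:~R + fl.

Definition T2 (eps : bool) (alpha : K) : K := alpha^-1 - (a2 eps alpha)%:A.

Fixpoint orbit2 (alpha : K) (k : nat) : K :=
  if k is k'.+1 then T2 (odd k) (orbit2 alpha k') else alpha.

(* alpha_(n) for n >= 1; orbit2 is indexed from 0. *)
Definition algo (alpha : K) (n : nat) : K := orbit2 alpha n.-1.

End algorithm.

Definition D2_1 : set (Q2 * Q2) :=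
  [set xy | (0 < v2 xy.1)%E /\ (v2 xy.2 <= 0)%E].

Definition Doo_1 (R : realType) : set (R * R) :=
  [set xy | `|xy.1| <= 1 /\ 1 < `|xy.1 - xy.2|].

(* Main.v *)
(* Let x_n be the orbit and y_n its conjugate.  Both satisfy z -> 1 / z - a_n,
   so |x - y| is divided by |x y| at each step, at either place.

   2-adically, v(x_n) > 0 for odd n and v(x_n) >= 0 for even n.  Once
   v(y_n) <= 0 for an odd n, or v(y_n) < 0 for an even n, the same holds at all
   later steps; as long as it fails, v(x_n - y_n) strictly decreases every two
   steps, which a periodic orbit excludes.

   At the real place, |x_n| < 1 for odd n and |x_n| <= 1/2 for even n, and
   d = |x - y| satisfies d'' > min(d, 1) after two steps.  Along a period this
   gives d > min(d, 1), that is d > 1. *)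

Require Import Defs.
From mathcomp Require Import all_boot all_order all_algebra all_field.
From mathcomp Require Import all_classical all_reals.
From mathcomp Require Import zify ring lra.

Set Implicit Arguments.
Unset Strict Implicit.
Unset Printing Implicit Defensive.

Import Order.TTheory GRing.Theory Num.Theory.
Local Open Scope classical_set_scope.
Local Open Scope ring_scope.

Local Notation "x %:F" := (@FracField.tofrac _ x).

(** * The 2-adic valuation on [Z2] *)

Lemma z2mod_eq0_le (x : Z2) m n :
  (m <= n)%N -> z2mod x n = 0 -> z2mod x m = 0.
Proof. by move=> /subnKC <- xn; rewrite -(z2modD x m (n - m)) xn mod0z. Qed.

Lemma z2mod_eq0 (x : Z2) n : x != 0 -> (z2mod x n == 0) = (n <= z2_ord x)%N.
Proof.
move=> /z2_ordP[x0 x1]; apply/eqP/idP => [xn|/z2mod_eq0_le]; last exact.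
by rewrite leqNgt; apply/negP => /z2mod_eq0_le /(_ xn).
Qed.

Lemma z2_ordE (x : Z2) n :
  z2mod x n = 0 -> z2mod x n.+1 <> 0 -> z2_ord x = n.
Proof.
move=> xn xSn; have x0 : x != 0.
  by apply: contra_notN xSn => /eqP ->; rewrite /= mod0z.
move/eqP: xn; move/eqP: xSn; rewrite !z2mod_eq0// -ltnNge ltnS => h1 h2.
by apply/eqP; rewrite eqn_leq h1 h2.
Qed.

(** The level [n] is free, so two elements can be read modulo the same power of 2. *)
Lemma z2_ord_lift (x : Z2) n : x != 0 -> (z2_ord x < n)%N ->
  exists2 q : int, z2mod x n = q * 2 ^+ z2_ord x & ~~ (2 %| q)%Z.
Proof.
by move=> x0 xn; have := z2_ord_odd (n - (z2_ord x).+1) x0; rewrite subnKC.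
Qed.

(** Since 2 is prime, the odd cofactors of [x] and [y] have an odd product; reading [x * y] modulo
    [2 ^ n.+1] is enough to see it. *)
Lemma z2_ordM (x y : Z2) : x != 0 -> y != 0 ->
  z2_ord (x * y) = (z2_ord x + z2_ord y)%N.
Proof.
move=> x0 y0; set n := (_ + _)%N.
have [|q xq qN] := @z2_ord_lift x n.+1 x0; first by rewrite ltnS leq_addr.
have [|r yr rN] := @z2_ord_lift y n.+1 y0; first by rewrite ltnS leq_addl.
have xyE : z2mod (x * y) n.+1 = (q * r * 2 ^+ n %% 2 ^+ n.+1)%Z.
  by rewrite /= xq yr mulrACA -exprD.
apply: z2_ordE.
  by rewrite -z2modP xyE modz_pow2S modzMl.
rewrite xyE => /dvdz_mod0P; rewrite exprS dvdz_mul2r ?expf_neq0//.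
by rewrite dvdzE abszM Euclid_dvdM// -!dvdzE (negbTE qN) (negbTE rN).
Qed.

Lemma z2_ord1 : z2_ord 1 = 0%N.
Proof. by apply: z2_ordE; rewrite ?z2mod0. Qed.

Lemma z2_ordD (x y : Z2) : x != 0 -> y != 0 -> x + y != 0 ->
  (minn (z2_ord x) (z2_ord y) <= z2_ord (x + y)%R)%N.
Proof.
move=> x0 y0 xy0; rewrite -z2mod_eq0//=; apply/eqP.
have -> : z2mod x (minn (z2_ord x) (z2_ord y)) = 0.
  by apply/eqP; rewrite z2mod_eq0 ?geq_minl.
have -> : z2mod y (minn (z2_ord x) (z2_ord y)) = 0.
  by apply/eqP; rewrite z2mod_eq0 ?geq_minr.
by rewrite mod0z.
Qed.

(** Two odd cofactors of the same power of 2 add up to an even one. *)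
Lemma z2_ordD_gt (x y : Z2) : x != 0 -> y != 0 -> x + y != 0 ->
  z2_ord x = z2_ord y -> (z2_ord x < z2_ord (x + y)%R)%N.
Proof.
move=> x0 y0 xy0 xy; rewrite -z2mod_eq0//=.
have [q -> qN] := z2_ord_lift x0 (ltnSn (z2_ord x)).
have [|r -> rN] := @z2_ord_lift y (z2_ord x).+1 y0; first by rewrite xy.
rewrite -xy -mulrDl exprS; apply/eqP/dvdz_mod0P.
rewrite dvdz_mul2r ?expf_neq0//.
lia.
Qed.

Lemma z2_ordN (x : Z2) : z2_ord (- x) = z2_ord x.
Proof.
have [->|x0] := eqVneq x 0; first by rewrite oppr0.
have [xn xSn] := z2_ordP x0.
apply: z2_ordE => /=; first by rewrite xn oppr0 mod0z.
move=> /dvdz_mod0P; rewrite rpredN => /dvdz_mod0P.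
by rewrite z2mod_small.
Qed.

(** * The valuation on [Q2] *)

Lemma Q2_repr (u : Q2) : u = (\n_(repr u))%:F / (\d_(repr u))%:F.
Proof.
have d0 : (\d_(repr u))%:F != 0 by rewrite tofrac_eq0 denom_ratioP.
apply: (mulIf d0); rewrite divfK//; rewrite -{1}[u]reprK.
move: (repr u) {d0} => r; apply/eqP; rewrite piE FracField.equivfE.
by rewrite !numden_Ratio ?mulf_neq0 ?denom_ratioP ?oner_neq0// !mulr1 mulrC.
Qed.

Lemma Q2_fraction (u : Q2) : u != 0 -> exists a b : Z2,
  [/\ a != 0, b != 0 & u = a%:F / b%:F].
Proof.
move=> u0; exists \n_(repr u), \d_(repr u); split;
  [|exact: denom_ratioP|exact: Q2_repr].
by apply: contraNneq u0 => n0; rewrite (Q2_repr u) n0 tofrac0 mul0r.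
Qed.

(** [v2] is read off a chosen representative; cross-multiplication shows that every other fraction
    gives the same difference of orders. *)
Lemma v2_fraction (a b : Z2) : a != 0 -> b != 0 ->
  v2 (a%:F / b%:F) = ((z2_ord a)%:Z - (z2_ord b)%:Z)%:E.
Proof.
move=> a0 b0; set u := _ / _.
have u0 : u != 0 by rewrite mulf_neq0 ?invr_eq0 ?tofrac_eq0.
rewrite /v2 /reverse_coercion (negbTE u0); congr EFin.
have d0 := denom_ratioP (repr u).
have n0 : \n_(repr u) != 0.
  by apply: contraNneq u0 => n0; rewrite (Q2_repr u) n0 tofrac0 mul0r.
have : a * \d_(repr u) = \n_(repr u) * b.
  apply/eqP; rewrite -tofrac_eq !tofracM -eqr_div ?tofrac_eq0//.
  by rewrite -Q2_repr.
by move=> /(congr1 z2_ord); rewrite !z2_ordM//; lia.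
Qed.

Lemma v2_0 : v2 0 = +oo%E.
Proof. by rewrite /v2 eqxx. Qed.

Lemma v2_fin (u : Q2) : u != 0 -> exists n : int, v2 u = n%:E.
Proof. by move=> u0; rewrite /v2 (negbTE u0); eexists. Qed.

Lemma v2M (u w : Q2) : v2 (u * w) = (v2 u + v2 w)%E.
Proof.
have [->|/[dup] u0 /Q2_fraction[a [b [a0 b0 ->]]]] := eqVneq u 0.
  by rewrite mul0r v2_0; have [->|/v2_fin[n ->]] := eqVneq w 0; rewrite ?v2_0.
have [->|/Q2_fraction[c [d [c0 d0 ->]]]] := eqVneq w 0.
  by rewrite mulr0 v2_0 v2_fraction.
rewrite mulf_div -!tofracM !v2_fraction ?mulf_neq0//.
rewrite -EFinD !z2_ordM//; congr EFin; lia.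
Qed.

Lemma v2N (u : Q2) : v2 (- u) = v2 u.
Proof.
have [->|/Q2_fraction[a [b [a0 b0 ->]]]] := eqVneq u 0; first by rewrite oppr0.
by rewrite -mulNr -tofracN !v2_fraction ?oppr_eq0// z2_ordN.
Qed.

Lemma v2_1 : v2 1 = 0%E.
Proof.
by rewrite -[1]divr1 -tofrac1 v2_fraction ?oner_neq0// subrr.
Qed.

Lemma z2_ord2 : z2_ord 2 = 1%N.
Proof. exact: z2_ordE. Qed.

Lemma v2_2 : v2 2 = 1%:E.
Proof.
have -> : 2 = (2%:R : Z2)%:F / 1%:F :> Q2 by rewrite tofrac1 divr1 rmorph_nat.
rewrite v2_fraction ?oner_neq0 ?z2_ord2 ?z2_ord1//.
by apply/eqP => /(congr1 (fun x : Z2 => z2mod x 2)).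
Qed.

Lemma Q2_2_neq0 : 2 != 0 :> Q2.
Proof. by apply/eqP => h; have := v2_2; rewrite h v2_0. Qed.

Lemma v2V (u : Q2) : u != 0 -> v2 u^-1 = (- v2 u)%E.
Proof.
move=> u0; have := v2M u u^-1; rewrite divff// v2_1.
have [m ->] := v2_fin u0.
have [|n ->] := @v2_fin u^-1; first by rewrite invr_eq0.
by rewrite -EFinD -EFinN => -[mn]; congr EFin; lia.
Qed.

Lemma v2_exp2 (n : int) : v2 (2 ^ n) = n%:E.
Proof.
have nat_case k : v2 (2 ^+ k) = k%:Z%:E.
  by elim: k => [|k IHk]; rewrite ?v2_1// exprS v2M v2_2 IHk -EFinD.
case: n => n; first exact: nat_case.
by rewrite NegzE -exprnN v2V ?expf_neq0 ?Q2_2_neq0// nat_case.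
Qed.

Lemma v2D (n : \bar int) (u w : Q2) :
  (n <= v2 u)%E -> (n <= v2 w)%E -> (n <= v2 (u + w)%R)%E.
Proof.
have [->|u0] := eqVneq u 0; first by rewrite add0r.
have [->|w0] := eqVneq w 0; first by rewrite addr0.
have [->|uw0] := eqVneq (u + w) 0; first by rewrite v2_0 leey.
have [a [b [a0 b0 uE]]] := Q2_fraction u0.
have [c [d [c0 d0 wE]]] := Q2_fraction w0.
have uwE : u + w = (a * d + c * b)%:F / (b * d)%:F.
  by rewrite uE wE addf_div ?tofrac_eq0// tofracD !tofracM.
have s0 : a * d + c * b != 0.
  by apply: contraNneq uw0; rewrite uwE => ->; rewrite tofrac0 mul0r.
rewrite uwE v2_fraction ?mulf_neq0// uE wE !v2_fraction//.
have := @z2_ordD (a * d) (c * b); rewrite !mulf_neq0// !z2_ordM//.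
move=> /(_ isT isT s0); case: n => [n||]; rewrite ?leNye ?leye_eq// !lee_fin.
by move: (z2_ord (a * d + c * b)) => e; lia.
Qed.

(* The residue field has two elements, so two units are congruent. *)
Lemma v2D_units (u w : Q2) :
  v2 u = 0%E -> v2 w = 0%E -> (1%:E <= v2 (u + w)%R)%E.
Proof.
have [->|u0] := eqVneq u 0; first by rewrite v2_0.
have [->|w0] := eqVneq w 0; first by rewrite v2_0.
have [->|uw0] := eqVneq (u + w) 0; first by rewrite v2_0 leey.
have [a [b [a0 b0 uE]]] := Q2_fraction u0.
have [c [d [c0 d0 wE]]] := Q2_fraction w0.
have uwE : u + w = (a * d + c * b)%:F / (b * d)%:F.
  by rewrite uE wE addf_div ?tofrac_eq0// tofracD !tofracM.
have s0 : a * d + c * b != 0.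
  by apply: contraNneq uw0; rewrite uwE => ->; rewrite tofrac0 mul0r.
rewrite uwE v2_fraction ?mulf_neq0// uE wE !v2_fraction// => -[ab] -[cd].
have := @z2_ordD_gt (a * d) (c * b); rewrite !mulf_neq0// !z2_ordM//.
move=> /(_ isT isT s0); rewrite lee_fin.
by move: (z2_ord (a * d + c * b)) => e; lia.
Qed.

(** If [u + w] had valuation above [v2 u], then so would [u = (u + w) - w]. *)
Lemma v2D_dominant (u w : Q2) : (v2 u < v2 w)%E -> v2 (u + w) = v2 u.
Proof.
move=> uw; have u0 : u != 0.
  by apply: contraTneq uw => ->; rewrite v2_0 ltNge leey.
have [e ue] := v2_fin u0; rewrite ue in uw *.
apply: le_anti; rewrite v2D ?ue ?(ltW uw)// andbT leNgt; apply/negP => uw_gt.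
(* Finite valuations are integers, so a strict inequality gains a full unit. *)
have ltS n : (e%:E < n)%E -> ((e + 1)%:E <= n)%E.
  by case: n => [n||]; rewrite ?leey// lte_fin lee_fin; lia.
have := v2D (ltS _ uw_gt) (n := (e + 1)%:E) (w := - w).
by rewrite v2N addrK ue lee_fin => /(_ (ltS _ uw)); lia.
Qed.

(** * Digit expansions and [floor2] *)

Lemma fsum_int_le (V : nmodType) (F : int -> V) (e m : int) (k : nat) :
  (forall n, n < e -> F n = 0) -> m + 1 = e + k%:Z ->
  \sum_(n \in [set n : int | n <= m]) F n = \sum_(i < k) F (e + i%:Z).
Proof.
move=> F0 mE; rewrite (fsbigE [seq e + i%:Z | i <- iota 0 k]); last first.
- move=> n /= nm; apply: contraNeq => /eqP Fn.
  have en : e <= n by rewrite leNgt; apply/negP => /F0.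
  by apply/mapP; exists `|n - e|%N; rewrite ?mem_iota/=; lia.
- by move=> n /= /mapP[i]; rewrite mem_iota => /andP[_ ik] ->; lia.
- by rewrite map_inj_uniq ?iota_uniq// => i j /addrI[].
rewrite big_map big_seq_cond -(big_mkord xpredT (fun i => F (e + i%:Z))).
rewrite [RHS]big_seq /index_iota subn0; apply: eq_bigl => i.
rewrite mem_iota /= add0n andb_idr// => ik; rewrite inE /=; lia.
Qed.

(** For [r] of nonnegative valuation this is its residue modulo 2. *)
Definition bit (r : Q2) : bool := v2 r == 0%E.

(** For a 2-adic integer [r], the [n] lowest digits are dropped and the rest is shifted down, so
    that the next [bit] is the digit of index [n]. *)
Fixpoint digit_tail (r : Q2) (n : nat) : Q2 :=
  if n is n'.+1 then (digit_tail r n' - (bit (digit_tail r n'))%:R) / 2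
  else r.

Lemma v2_sub_bit (r : Q2) :
  (0%E <= v2 r)%E -> (1%:E <= v2 (r - (bit r)%:R)%R)%E.
Proof.
rewrite /bit; case: (eqVneq (v2 r) 0%E) => [r0 _|r0].
  by apply: v2D_units; rewrite // v2N v2_1.
rewrite subr0; case: (v2 r) r0 => [n||]; rewrite ?leey// !lee_fin eqe; lia.
Qed.

Lemma v2_div2 (r : Q2) : (1%:E <= v2 r)%E -> (0 <= v2 (r / 2)%R)%E.
Proof.
rewrite v2M v2V ?Q2_2_neq0// v2_2.
by case: (v2 r) => [n||]; rewrite -?EFinN// -EFinD !lee_fin; lia.
Qed.

Lemma v2_digit_tail (r : Q2) n :
  (0%E <= v2 r)%E -> (0%E <= v2 (digit_tail r n))%E.
Proof. by move=> r0; elim: n => //= n /v2_sub_bit/v2_div2. Qed.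

Lemma digit_expansion (r : Q2) n :
  r = \sum_(i < n) (bit (digit_tail r i))%:R * 2 ^+ i + 2 ^+ n * digit_tail r n.
Proof.
elim: n => [|n IHn]; first by rewrite big_ord0 add0r mul1r.
rewrite [LHS]IHn big_ord_recr /= -addrA; congr (_ + _).
rewrite exprSr -mulrA [2 * _]mulrC divfK ?Q2_2_neq0// mulrBr.
by rewrite [_%:R * _]mulrC addrC subrK.
Qed.

(** Dividing by [2 ^ e], with [e] the valuation of [u], reduces to a 2-adic integer, whose digits
    are the bits of its successive tails. *)
Lemma digits_exist (u : Q2) : exists c, is_digits u c.
Proof.
have [->|u0] := eqVneq u 0.
  exists (fun=> false); split=> // M; exists 0%N => // N _ /=.
  by rewrite fsbig1 ?subr0 ?v2_0 ?leey// => n _; rewrite mul0r.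
have [e ue] := v2_fin u0.
pose r := u / 2 ^ e.
have r0 : (0%E <= v2 r)%E.
  rewrite /r v2M v2V ?v2_exp2 ?expfz_neq0 ?Q2_2_neq0// ue -EFinN -EFinD subrr.
  by [].
pose c (n : int) := (e <= n) && bit (digit_tail r `|n - e|%N).
have c0 n : n < e -> c n = false by rewrite /c ltNge => /negbTE ->.
exists c; split=> [n|M]; first by rewrite ue lte_fin; exact: c0.
(* The digits of index [e] to [N] number [N + 1 - e], and the error then has valuation at least
   [N + 1], which exceeds [M] from this rank on. *)
exists (`|e| + `|M|)%N => // N /= hN.
rewrite (@fsum_int_le _ _ e _ (absz (N%:Z + 1 - e)%R)); last 2 first.
- by move=> n /c0 ->; rewrite mul0r.
- lia.
set k := absz _.
have -> : \sum_(i < k) (c (e + i%:Z))%:R * 2 ^ (e + i%:Z) =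
    2 ^ e * \sum_(i < k) (bit (digit_tail r i))%:R * 2 ^+ i :> Q2.
  rewrite mulr_sumr; apply: eq_bigr => i _.
  rewrite /c lerDl /= addrAC subrr add0r absz_nat.
  by rewrite expfzDr ?Q2_2_neq0// mulrCA.
have {1}-> : u = 2 ^ e * r by rewrite /r mulrC divfK ?expfz_neq0 ?Q2_2_neq0.
rewrite -mulrBr {1}(digit_expansion r k) [_ + _ - _]addrAC subrr add0r.
rewrite !v2M v2_exp2 (v2_exp2 k).
have := v2_digit_tail k r0; case: (v2 _) => [n||]//;
  last by rewrite !addey ?leey.
by rewrite -!EFinD !lee_fin /k; lia.
Qed.

(** The digits left after removing those of index at most 0 carry positive powers of 2. The morphism
    [f] reads the rational [floor2 u] in [Q2]; it will be [s2] restricted to the rationals. *)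
Lemma v2_sub_floor2 (f : {rmorphism rat -> Q2}) (u : Q2) :
  (1%:E <= v2 (u - f (floor2 u))%R)%E.
Proof.
have : is_digits u (digits u).
  by rewrite /digits; apply: xgetPex; exact: digits_exist.
rewrite /floor2; move: (digits u) => c [c_low c_lim].
have [k ck] : exists k : nat, forall n : int, n < - k%:Z -> c n = false.
  have [u0|/v2_fin[e ue]] := eqVneq u 0.
    by exists 0%N => n _; apply: c_low; rewrite u0 v2_0 ltey.
  by exists `|e|%N => n hn; apply: c_low; rewrite ue lte_fin; lia.
have [N _ /(_ N (leqnn N))] := c_lim 1.
rewrite (@fsum_int_le _ _ (- k%:Z) 0 k.+1); [| |lia]; last first.
  by move=> n /ck ->; rewrite mul0r.
rewrite (@fsum_int_le _ _ (- k%:Z) N (k.+1 + N)); [| |lia]; last first.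
  by move=> n /ck ->; rewrite mul0r.
rewrite big_split_ord /= rmorph_sum /=.
rewrite [X in _ -> (_ <= v2 (u - X)%R)%E](eq_bigr
  (fun i : 'I_k.+1 => (c (- k%:Z + i%:Z))%:R *
    2 ^ (- k%:Z + i%:Z))); last first.
  by move=> i _; rewrite rmorphM rmorph_nat fmorphXz rmorph_nat.
set s := \sum_(i < k.+1) _; set t := \sum_(i < N) _ => h.
(* The partial sum [s + t] is within precision 1 of [u], and [t] only involves the powers from
   [2 ^ 1] to [2 ^ N]. *)
have -> : u - s = u - (s + t) + t by rewrite opprD addrA subrK.
apply: v2D => //; rewrite /t; elim/big_ind: _ => [|x y|i _].
- by rewrite v2_0 leey.
- exact: v2D.
rewrite v2M v2_exp2; case: (c _); last by rewrite v2_0 leey.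
by rewrite v2_1 add0e lee_fin; lia.
Qed.

Lemma v2_intr (m : int) : (0%E <= v2 m%:~R)%E.
Proof.
have v2_natr n : (0%E <= v2 n%:R)%E.
  elim: n => [|n IHn]; first by rewrite v2_0 leey.
  by rewrite -natr1; apply: v2D; rewrite // v2_1.
by case: m => n; rewrite ?NegzE ?mulrNz ?v2N; exact: v2_natr.
Qed.

(** * Real size and 2-adic valuation after one step *)

Lemma smallest_minimizer_le (R : realType) (s : int) (c d : R) : 0 < s ->
  `|c - (s * smallest_minimizer (fun i => `|c - (s * i)%:~R - d|))%:~R - d|
    <= s%:~R / 2.
Proof.
move=> s0; pose f (i : int) : R := `|c - (s * i)%:~R - d|; rewrite -/f.
have s0' : 0 < s%:~R :> R by rewrite ltr0z.
(* This rounds [(c - d) / s] to the nearest integer with ties going down, hence gives the smallest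
   minimizer. *)
pose m := Num.ceil ((c - d) / s%:~R - 2^-1).
have fE i : f i = s%:~R * `|(c - d) / s%:~R - i%:~R|.
  rewrite -[X in X * _](gtr0_norm s0') -normrM mulrBr mulrCA divff ?gt_eqF//.
  by rewrite mulr1 -intrM /f addrAC.
have [m_lt m_ge] : m%:~R - 1 < (c - d) / s%:~R - 2^-1 /\
    (c - d) / s%:~R - 2^-1 <= m%:~R.
  split; last exact: ceil_ge.
  by have := ceilB1_lt ((c - d) / s%:~R - 2^-1); rewrite intrB.
set t := (c - d) / s%:~R in fE m_lt m_ge.
have m_near : `|t - m%:~R| <= 2^-1 by rewrite ler_norml; apply/andP; split; lra.
have m_min : (forall i, f m <= f i) /\
    (forall m', (forall i, f m' <= f i) -> m <= m').
  have above i : i < m -> 2^-1 < t - i%:~R.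
    by rewrite -lezD1 -(ler_int R) intrD => im; lra.
  split=> [i|m' /(_ m)]; rewrite !fE ler_pM2l//.
    have [im|mi|-> //] := ltgtP i m; apply: le_trans m_near _.
    - by apply: le_trans (ler_norm _); exact/ltW/above.
    - move: mi; rewrite -lezD1 -(ler_int R) intrD => mi.
      by rewrite -normrN (le_trans _ (ler_norm _))//; lra.
  move=> h; rewrite leNgt; apply/negP => /above.
  by rewrite ltNge (le_trans (ler_norm _) (le_trans h m_near)).
(* As [m] shows that a smallest minimizer exists, the default 0 is not what [xget] returns by
   failure, and the returned value does at least as well as [m]. *)
have [/(_ m) + _] := xgetPex (P := [set m : int | (forall i, f m <= f i) /\
  (forall m', (forall i, f m' <= f i) -> m <= m')]) 0 (ex_intro _ m m_min).
rewrite -/(smallest_minimizer f).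
by move=> /le_trans; apply; rewrite fE ler_pM2l.
Qed.

Section orbit.
Variables (R : realType) (K : fieldExtType rat).
Variables (soo : {rmorphism K -> R}) (s2 : {rmorphism K -> Q2}).

Lemma soo_T2 (eps : bool) (x : K) :
  `|soo (T2 soo s2 eps x)| <= (step eps)%:~R / 2.
Proof.
rewrite /T2 rmorphB /= /a2 alg_num_field fmorph_rat rmorphD /= ratr_int.
rewrite opprD addrA; apply: smallest_minimizer_le.
by case: eps.
Qed.

(** Subtracting [floor2] leaves valuation at least 1; the remaining multiple of [step eps] is even
    for [eps = false], but only a 2-adic integer for [eps = true]. *)
Lemma v2_T2 (eps : bool) (x : K) :
  ((~~ eps)%:Z%:E <= v2 (s2 (T2 soo s2 eps x)))%E.
Proof.
rewrite /T2 /a2; set m := smallest_minimizer _; set fl := floor2 _.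
have -> : s2 (x^-1 - ((step eps * m)%:~R + fl)%:A) =
    (s2 x^-1 - (s2 \o in_alg K) fl) - (step eps)%:~R * m%:~R.
  rewrite rmorphB scalerDl rmorphD opprD addrA addrAC /=; congr (_ - _ - _).
  by rewrite scaler_int rmorph_int intrM.
apply: v2D.
  by apply: le_trans (v2_sub_floor2 _ _); rewrite lee_fin; case: (eps).
rewrite v2N v2M; have := v2_intr m; case: (eps) => /=;
  rewrite ?v2_1 ?v2_2 ?add0e//.
by case: (v2 _) => [n||]//; rewrite -EFinD !lee_fin; lia.
Qed.

(** * Irrationality and conjugation along the orbit; [1%VS] is the copy of the rationals in [K] *)

Lemma T2_irrational (eps : bool) (x : K) :
  (T2 soo s2 eps x \in 1%VS) = (x \in 1%VS).
Proof.
by rewrite rpredBr ?rpredZ ?rpred1 // rpredV.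
Qed.
End orbit.

Lemma orbit2_irrational (R : realType) (K : fieldExtType rat)
    (soo : {rmorphism K -> R}) (s2 : {rmorphism K -> Q2}) (x : K) k :
  (orbit2 soo s2 x k \in 1%VS) = (x \in 1%VS).
Proof. by elim: k => //= k IHk; rewrite T2_irrational IHk. Qed.

(** The integer part is rational, hence fixed by [conj], and cancels. *)
Lemma conj_T2 (R : realType) (K : fieldExtType rat)
    (soo : {rmorphism K -> R}) (s2 : {rmorphism K -> Q2})
    (conj : {rmorphism K -> K}) (eps : bool) (x : K) :
  T2 soo s2 eps x - conj (T2 soo s2 eps x) = x^-1 - (conj x)^-1.
Proof.
rewrite /T2 rmorphB /= fmorphV alg_num_field fmorph_rat.
by rewrite opprD addrACA subrr addr0.
Qed.

(** An irrational [x] generates the quadratic field, so a morphism fixing [x] would be the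
    identity. *)
Lemma conj_irrational_neq (K : fieldExtType rat) (conj : {rmorphism K -> K})
    (x : K) :
  \dim {:K} = 2%N -> (exists y : K, conj y <> y) -> x \notin 1%VS ->
  conj x != x.
Proof.
move=> dimK [y cy] xQ; apply: contra_notN cy => /eqP cx.
have /Fadjoin_polyP[p pQ ->] : y \in <<1; x>>%VS.
  suff -> : <<1; x>>%VS = fullv by rewrite memvf.
  apply/eqP; rewrite eqEdim subvf dimK dim_Fadjoin dimv1 muln1.
  by rewrite ltn_neqAle eq_sym adjoin_deg_eq1 xQ /= lt0n.
rewrite -horner_map /= cx; congr _.[_]; apply/polyP => i; rewrite coef_map /=.
have /vlineP[q ->] := polyOverP pQ i.
by rewrite alg_num_field fmorph_rat.
Qed.

(** * Two consecutive steps at each place *)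

Lemma invB_mul (F : fieldType) (x y : F) : x != 0 -> y != 0 ->
  (x^-1 - y^-1) * (x * y) = y - x.
Proof. by move=> x0 y0; field; rewrite x0 y0. Qed.

(* With [d = |x - y|], one step divides [d] by [|x y| <= |x| (|x| + d)];
   the two bounds on [|x|] make the composite larger than [4 d / (1 + 3 d)],
   which is at least [min d 1]. *)
Lemma dist_two_steps (R : realType) (x0 y0 x1 y1 x2 y2 : R) :
  x0 != 0 -> y0 != 0 -> x1 != 0 -> y1 != 0 -> x0 != y0 ->
  `|x0| < 1 -> `|x1| <= 2^-1 ->
  x1 - y1 = x0^-1 - y0^-1 -> x2 - y2 = x1^-1 - y1^-1 ->
  Num.min `|x0 - y0| 1 < `|x2 - y2|.
Proof.
move=> x00 y00 x10 y10 xy0 x0_lt x1_le e1 e2.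
have inv_dist (x y x' y' : R) : x != 0 -> y != 0 -> x' - y' = x^-1 - y^-1 ->
    `|x' - y'| * (`|x| * `|y|) = `|x - y|.
  by move=> xn yn ->; rewrite -!normrM invB_mul// distrC.
have norm_y (x y : R) : `|y| <= `|x| + `|x - y|.
  rewrite -[y in `|y|](subKr x) (le_trans (ler_normB _ _))//.
have := inv_dist _ _ _ _ x00 y00 e1; have := inv_dist _ _ _ _ x10 y10 e2.
have := norm_y x0 y0; have := norm_y x1 y1.
have : 0 < `|x0 - y0| by rewrite normr_gt0 subr_eq0.
move: x0_lt x1_le; rewrite -!normr_gt0 in x00 y00 x10 y10.
move: `|x0 - y0| `|x1 - y1| `|x2 - y2| `|x0| `|y0| `|x1| `|y1| x00 y00 x10 y10.
move=> d0 d1 d2 a0 b0 a1 b1 a0p b0p a1p b1p a0_lt a1_le d0p h1 h0 E2 E1.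
have d1p : 0 < d1 by rewrite -(pmulr_lgt0 d1 (mulr_gt0 a0p b0p)) E1.
have d2p : 0 < d2 by rewrite -(pmulr_lgt0 d2 (mulr_gt0 a1p b1p)) E2.
(* The divisor satisfies [a0 * b0 < 1 + d0], from [a0 < 1] and [b0 <= a0 + d0]. *)
have d1_gt : d0 < d1 * (1 + d0).
  rewrite -E1 ltr_pM2l// E1; nra.
(* Here [a1 <= 1/2] gives [a1 * b1 <= (1 + 2 * d1) / 4]. *)
have d2_ge : d1 * 4 <= d2 * (1 + 2 * d1).
  rewrite -E2 -mulrA ler_pM2l//; nra.
rewrite ltNge; apply/negP; rewrite le_min => /andP[d2d0 d21].
nra.
Qed.

(** If [v(y0) <= 0], then [v(y1) = - v(x0) < 0]; if [v(y1) < 0], then [v(y2) = - v(x1) <= 0].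
    Otherwise the gap loses [v(x0) + v(y0) + v(x1) + v(y1)], which is positive. *)
Lemma v2_two_steps (x0 y0 x1 y1 x2 y2 : Q2) :
  x0 != 0 -> y0 != 0 -> x1 != 0 -> y1 != 0 ->
  (1%:E <= v2 x0)%E -> (0%E <= v2 x1)%E -> (1%:E <= v2 x2)%E ->
  x1 - y1 = x0^-1 - y0^-1 -> x2 - y2 = x1^-1 - y1^-1 -> x0 != y0 ->
  (v2 y2 <= 0%E)%E \/ (0%E < v2 y0)%E /\ (v2 (x2 - y2)%R < v2 (x0 - y0)%R)%E.
Proof.
move=> x00 y00 x10 y10 vx0 vx1 vx2 e1 e2 xy0.
(* The pole [1 / x] dominates [y' = x' + 1 / y - 1 / x]. *)
have dominant (x y x' y' : Q2) (n : int) : x != 0 ->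
    x' - y' = x^-1 - y^-1 ->
    (n%:E <= v2 x')%E -> (n%:E <= v2 (y^-1)%R)%E -> (v2 (x^-1)%R < n%:E)%E ->
    v2 y' = v2 x^-1.
  move=> x_neq0 e vx' vy lt_n; have -> : y' = - x^-1 + (x' + y^-1).
    by rewrite -[y' in LHS](subKr x') e opprB addrA addrC addrA.
  by rewrite v2D_dominant v2N// (lt_le_trans lt_n)// v2D.
have inv_dist (x y x' y' : Q2) : x != 0 -> y != 0 -> x' - y' = x^-1 - y^-1 ->
    (v2 (x' - y')%R + (v2 x + v2 y))%E = v2 (x - y).
  by move=> xn yn ->; rewrite -!v2M invB_mul// -v2N opprB.
have := inv_dist _ _ _ _ x10 y10 e2; have := inv_dist _ _ _ _ x00 y00 e1.
(* The thresholds 0 and 1 are the lower bounds on the valuations of [x1] and [x2]. *)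
have := dominant _ _ _ _ 0 x00 e1 vx1; have := dominant _ _ _ _ 1 x10 e2 vx2.
have [d dE] : exists d, v2 (x0 - y0) = d%:E by apply: v2_fin; rewrite subr_eq0.
rewrite !v2V// dE; have [b0 yE0] := v2_fin y00; have [b1 yE1] := v2_fin y10.
move: vx0 vx1; have [a0 ->] := v2_fin x00; have [a1 ->] := v2_fin x10.
rewrite yE0 yE1 -!EFinN -!EFinD !lee_fin !lte_fin => a0_gt a1_ge D2 D1.
case: (v2 (x1 - y1)) => [d1||]//; rewrite -EFinD => -[E1].
case: (v2 (x2 - y2)) => [d2||]//; rewrite -EFinD => -[E2].
rewrite lte_fin; have [b0_le|b0_gt] := leP b0 0.
  have [b1E] : b1%:E = (- a0)%:E by apply: D1; lia.
  by left; rewrite D2 ?lee_fin; lia.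
have [b1_lt|b1_ge] := ltP b1 0; last by right; lia.
by left; rewrite D2 ?lee_fin; lia.
Qed.

(** * Iteration along the period *)

Theorem theorem3p12 (R : realType) (K : fieldExtType rat)
    (quadratic_K : \dim {:K} = 2%N)
    (soo : {rmorphism K -> R}) (s2 : {rmorphism K -> Q2})
    (conj : {rmorphism K -> K}) (conj_neq_id : exists x : K, conj x <> x)
    (alpha : K) (alpha_irrational : alpha \notin 1%VS)
    (alpha_I : property_I soo s2 alpha)
    (alpha_periodic : exists n1 : nat,
       [/\ odd n1, (1 < n1)%N & algo soo s2 alpha 1 = algo soo s2 alpha n1]) :
  D2_1 (s2 alpha, s2 (conj alpha)) /\
  Doo_1 (soo alpha, soo (conj alpha)).
Proof.
have [/andP[alpha_gt alpha_le] alpha_v2] := alpha_I.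
have alpha_norm : `|soo alpha| <= 1 by rewrite ler_norml ltW.
have [n1 [n1_odd n1_gt]] := alpha_periodic; rewrite /algo /= => period.
pose x k := orbit2 soo s2 alpha k.
(* As [n1] is odd, the period consists of [p] double steps. *)
have [p p_gt0 n1E] : exists2 p, (0 < p)%N & n1.-1 = p.*2.
  by exists n1./2; lia.
have xQ k : x k \notin 1%VS by rewrite /x orbit2_irrational.
have irr_neq0 (y : K) : y \notin 1%VS -> y != 0.
  by apply: contraNneq => ->; rewrite mem0v.
have x0 k : x k != 0 by exact: irr_neq0.
have c0 k : conj (x k) != 0 by rewrite fmorph_eq0.
have xc k : x k != conj (x k) by rewrite eq_sym conj_irrational_neq.
have diff k : x k.+1 - conj (x k.+1) = (x k)^-1 - (conj (x k))^-1.
  exact: conj_T2.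
(* Indices start at 0 here, so even ones correspond to odd [n] in the algorithm. *)
have xE k : x k.+1.*2 = T2 soo s2 false (x k.*2.+1).
  by rewrite doubleS /x /= odd_double.
have xO k : x k.*2.+1 = T2 soo s2 true (x k.*2) by rewrite /x /= odd_double.
have real_even k : `|soo (x k.*2)| <= 1.
  case: k => // k; rewrite xE; apply: le_trans (soo_T2 _ _ _ _) _.
  by rewrite divff ?pnatr_eq0.
(* Equality would make the irrational [x k.*2] equal to 1 or -1. *)
have real_even_lt k : `|soo (x k.*2)| < 1.
  rewrite lt_neqAle real_even andbT; apply: contraNneq (xQ k.*2).
  move=> /eqP; rewrite eqr_norml ler01 andbT.
  rewrite -(rmorph1 soo) -rmorphN !fmorph_eq.
  by case/orP => /eqP ->; rewrite ?memvN mem1v.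
have real_odd k : `|soo (x k.*2.+1)| <= 2^-1.
  by rewrite xO; apply: le_trans (soo_T2 _ _ _ _) _; rewrite mul1r.
have two_even k : (1%:E <= v2 (s2 (x k.*2)))%E.
  case: k => [|k]; last by rewrite xE; exact: (v2_T2 soo s2 false).
  by move: alpha_v2; case: (v2 _) => [n||]//; rewrite ?leey// lte_fin lee_fin.
have two_odd k : (0%E <= v2 (s2 (x k.*2.+1)))%E.
  by rewrite xO; exact: (v2_T2 soo s2 true).
pose dist k := `|soo (x k.*2) - soo (conj (x k.*2))|.
pose gap k := v2 (s2 (x k.*2) - s2 (conj (x k.*2))).
have embed_diff (F : fieldType) (f : {rmorphism K -> F}) k :
    f (x k.+1) - f (conj (x k.+1)) = (f (x k))^-1 - (f (conj (x k)))^-1.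
  by rewrite -rmorphB diff rmorphB !fmorphV.
have dist_step k : Num.min (dist k) 1 < dist k.+1.
  apply: (@dist_two_steps _ _ _ (soo (x k.*2.+1)) (soo (conj (x k.*2.+1))));
    rewrite ?fmorph_eq0 ?fmorph_eq ?doubleS//; exact: embed_diff.
have gap_step k : (v2 (s2 (conj (x k.+1.*2))) <= 0%E)%E \/
    (0%E < v2 (s2 (conj (x k.*2))))%E /\ (gap k.+1 < gap k)%E.
  apply: (@v2_two_steps _ _ (s2 (x k.*2.+1)) (s2 (conj (x k.*2.+1))));
    rewrite ?fmorph_eq0 ?fmorph_eq//; exact: embed_diff.
have xp : x p.*2 = x 0%N by rewrite -n1E /x -period.
have [q pE] : exists q, p = q.+1 by exists p.-1; rewrite prednK.
split; split=> //=.
(* A nonpositive valuation of the conjugate persists, since the other alternative of [gap_step]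
   requires it to be positive. At [k = q] the orbit is back at its start, where the gap cannot be
   smaller than itself. *)
- have grow k : (v2 (s2 (conj (x k.+1.*2))) <= 0%E)%E \/ (gap k.+1 < gap 0%N)%E.
    elim: k => [|k IHk]; first by have [|[]] := gap_step 0%N; [left|right].
    have [|[v_gt lt_gap]] := gap_step k.+1; first by left.
    by case: IHk => [|/(lt_trans lt_gap)]; [rewrite leNgt v_gt|right].
  by have [|] := grow q; rewrite -pE /gap xp ?ltxx.
(* The lower bound [min(d, 1)] is inherited at each double step; after a full period it reads
   [min(d, 1) < d], which forces [d > 1]. *)
- have grow k : Num.min (dist 0%N) 1 < dist k.+1.
    elim: k => // k IHk; apply: le_lt_trans (dist_step k.+1).
    by rewrite le_min (ltW IHk) ge_min lexx orbT.
  by have := grow q; rewrite -pE /dist xp gt_min ltxx.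
Qed.
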